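(* Let $t\neq 1$ be fixed and let $F=F(t,x)=\dfrac{1}{e^{x(t-1)}-t}$, viewed as a function of $x$. Define $a_i(N,t)$ for integers $N\ge 0$ and $0\le i\le N$ by $a_0(N,t)=1$ for all $N\ge 0$, and \[ a_i(N,t)=i\,t\sum_{j=0}^{N-i}(i+1)^{j}\,a_{i-1}(N-j-1,t)\qquad (1\le i\le N). \] Then for every $N\in\mathbb{N}\cup\{0\}$, $F$ satisfies the nonlinear differential equation \[ \left(\frac{d}{dx}\right)^{N}F=(1-t)^{N}\sum_{i=1}^{N+1}a_{i-1}(N,t)\,F^{i}. \]
   Context: Differentiation is with respect to $x$ with $t$ held fixed; $F^{i}$ denotes the $i$-th power of $F$. *)

(* Defs.v *)
From HB Require Import structures.
From mathcomp Require Import all_boot all_order all_algebra.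
From mathcomp Require Import complex.
From mathcomp Require Import all_classical all_reals all_analysis.
Set Implicit Arguments.
Unset Strict Implicit.
Unset Printing Implicit Defensive.
Import Order.TTheory GRing.Theory Num.Theory.
Import numFieldNormedType.Exports.
Local Open Scope classical_set_scope.
Local Open Scope ring_scope.

(* Only the values with [i <= N] are meaningful; there the subtractions
   [N - i] and [N - j - 1] are never truncated. *)
Fixpoint eulerian_coef (K : comPzRingType) (i N : nat) (t : K) : K :=
  if i is i'.+1 then
    i%:R * t *
      \sum_(0 <= j < (N - i).+1)
         i.+1%:R ^+ j * eulerian_coef i' (N - j - 1) t
  else 1.

Definition expC (R : realType) (z : R[i]) : R[i] :=
  let: Complex a b := z in Complex (expR a * cos b) (expR a * sin b).

(* [e] is the exponential function of [K]. The inverse of [0] is [0] in [K], so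
   this is the mathematical function only where the denominator is nonzero. The
   copy [K^o] carries the topology and the norm of [K]. *)
Definition eulerian_F (K : numFieldType) (e : K -> K) (t : K) : K -> K^o :=
  fun x => (e (x * (t - 1)) - t)^-1.

(* Main.v *)
Require Import Defs.
From mathcomp Require Import all_boot all_order all_algebra.
From mathcomp Require Import complex.
From mathcomp Require Import all_classical all_reals all_analysis.
From mathcomp Require Import ring lra zify.
Import Order.TTheory GRing.Theory Num.Theory.
Import numFieldNormedType.Exports.
Local Open Scope ring_scope.
Local Open Scope classical_set_scope.

(* F' = (1 - t) (F + t F^2), so if F^(N) = P_N(F) for a polynomial P_N then
   F^(N+1) = (1 - t) P_N'(F) (F + t F^2); comparing coefficients, this is the
   recurrence a_i(N+1) = (i+1) a_i(N) + i t a_(i-1)(N), which follows from the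
   definition of a_i by splitting off the term j = 0. The argument only uses
   that e' = e for the exponential e. Over R[i] this is reduced by
   e^(z+h) = e^z e^h to e^h - 1 - h = o(h), itself a consequence of the
   derivatives at 0 of the real functions exp, cos and sin. *)

(** * Recurrences for the coefficients and the polynomials *)

Lemma eulerian_coefS (K : comPzRingType) (i N : nat) (t : K) : (i < N)%N ->
  eulerian_coef i.+1 N.+1 t =
    i.+2%:R * eulerian_coef i.+1 N t + i.+1%:R * t * eulerian_coef i N t.
Proof.
move=> ltiN /=; have -> : (N.+1 - i.+1 = (N - i.+1).+1)%N by lia.
rewrite big_nat_recl //= expr0 mul1r subn0 subn1 /= mulrDr addrC; congr (_ + _).
rewrite [RHS]mulrCA; congr (_ * _); rewrite mulr_sumr.
apply: eq_big_nat => j _; rewrite exprS -mulrA.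
by have -> : (N.+1 - j.+1 - 1 = N - j - 1)%N by lia.
Qed.

(** On the diagonal the sum has only the term j = 0. This case is separate because the general
    recurrence would involve [eulerian_coef N.+1 N], an out-of-range value that need not vanish. *)
Lemma eulerian_coef_diag (K : comPzRingType) (N : nat) (t : K) :
  eulerian_coef N.+1 N.+1 t = N.+1%:R * t * eulerian_coef N N t.
Proof. by rewrite /= subnn big_nat1 expr0 mul1r subn0 subn1. Qed.

Local Arguments eulerian_coef : simpl never.

Definition eulerian_poly (K : comNzRingType) (N : nat) (t : K) : {poly K} :=
  (1 - t) ^+ N *: \sum_(i < N.+1) eulerian_coef i N t *: 'X^(i.+1).

Lemma eulerian_polyS (K : comNzRingType) (N : nat) (t : K) :
  eulerian_poly K N.+1 t =
    (1 - t) *: ((eulerian_poly K N t)^`() * ('X + t *: 'X^2)).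
Proof.
rewrite /eulerian_poly derivZ -scalerAl scalerA -exprS; congr (_ *: _).
rewrite raddf_sum /= mulr_suml.
under [RHS]eq_bigr => i _.
  rewrite derivZ derivXn /= -scalerAl mulrnAl mulrDr -exprSr -scalerAr -exprD.
  rewrite addn2 -scaler_nat scalerA scalerDr scalerA.
  over.
(* The lowest term carries a_0 = 1 on both sides and the highest one the diagonal coefficient; the
   terms in between match by the recurrence. *)
rewrite big_split /= [LHS]big_ord_recl [X in _ = X + _]big_ord_recl /=.
rewrite mulr1 -addrA; congr (_ + _).
rewrite big_ord_recr [X in _ = _ + X]big_ord_recr /= addrA /bump !leq0n !add1n.
rewrite -big_split; congr (_ + _).
  apply: eq_bigr => i _; rewrite /= add1n -scalerDl; congr (_ *: _).
  by rewrite eulerian_coefS //; ring.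
by rewrite eulerian_coef_diag; congr (_ *: _); ring.
Qed.

Lemma eulerian_polyE (K : comNzRingType) (N : nat) (t y : K) :
  (eulerian_poly K N t).[y] =
    (1 - t) ^+ N * \sum_(1 <= i < N.+2) eulerian_coef (i - 1) N t * y ^+ i.
Proof.
rewrite hornerZ horner_sum big_add1 big_mkord; congr (_ * _).
by apply: eq_bigr => i _; rewrite hornerZ hornerXn subn1.
Qed.

(** * Derivatives of F, given an exponential with e' = e *)

Section Derivative.
Variable K : numFieldType.
Implicit Types (f e : K -> K) (x t : K).

Lemma is_derive_horner (p : {poly K}) f x (df : K) :
  is_derive x 1 f df -> is_derive x 1 (fun y => p.[f y]) (p^`().[f x] * df).
Proof.
move=> dfx; elim/poly_ind: p => [|p c ih].
  have -> : (fun y => (0 : {poly K}).[f y]) = cst 0.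
    by apply/funext => y; rewrite horner0.
  by rewrite deriv0 horner0 mul0r; exact: is_derive_cst.
have -> : (fun y => (p * 'X + c%:P).[f y]) = (fun y => p.[f y]) * f + cst c.
  by apply/funext => y; rewrite !hornerE.
apply: is_derive_eq; rewrite derivMXaddC !hornerE /GRing.scale /=.
ring.
Qed.

(** In one variable derivability is differentiability, so the chain rule for differentials applies;
    by linearity the differential of [e] at [x * a] sends a to a times its value at 1. *)
Lemma is_derive_scale_arg e x (a de : K) :
  is_derive (x * a) 1 e de -> is_derive x 1 (fun y => e (y * a)) (a * de).
Proof.
move=> [dex eE]; pose m := fun y : K => y * a.
have dm : is_derive x 1 m a.
  have -> : m = a \*: (id : K -> K) by apply/funext => y; exact: mulrC.
  by apply: is_derive_eq; exact: mulr1.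
have /derivable1_diffP dmx := @ex_derive _ _ _ _ _ _ _ dm.
move/derivable1_diffP : (dex) => dex'.
have dem : differentiable (e \o m) x by exact: differentiable_comp.
apply: DeriveDef; first exact/derivable1_diffP.
have dm1 : 'd m x 1 = a by rewrite -(deriveE _ dmx); exact: derive_val.
rewrite (deriveE _ dem).
have -> := congr1 (@^~ 1) (diff_comp dmx dex').
transitivity ('d e (m x) a); first by congr ('d e (m x) _).
by rewrite -[X in 'd _ _ X]mulr1 [LHS]linearZ /= -(deriveE _ dex') eE.
Qed.

(** With g the denominator, g' = (t - 1)(g + t), hence F' = -g'/g^2 = (1 - t)(1/g + t/g^2). *)
Lemma is_derive_eulerian_F e t x : (forall z : K, is_derive z 1 e (e z)) ->
  e (x * (t - 1)) - t != 0 -> let F := eulerian_F e t in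
  is_derive x 1 F ((1 - t) * (F x + t * F x ^+ 2)).
Proof.
move=> de dne0 F; pose g y := e (y * (t - 1)) - t.
have dg : is_derive x 1 g ((t - 1) * e (x * (t - 1))).
  have dex := is_derive_scale_arg _ _ _ _ (de (x * (t - 1))).
  have := is_deriveB dex (is_derive_cst t x 1).
  by rewrite subr0.
apply: DeriveDef; first exact: (derivableV (f := g)).
rewrite (deriveV (f := g)) // derive_val /GRing.scale /= /F /eulerian_F.
by rewrite /g; field.
Qed.

(** The formula for F^(N) can be differentiated at x only if it holds near x; continuity of the
    denominator ensures that the formula applies there. *)
Lemma near_eulerian_F_ne0 e t x : (forall z : K, is_derive z 1 e (e z)) ->
  e (x * (t - 1)) - t != 0 -> \forall y \near x, e (y * (t - 1)) - t != 0.
Proof.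
move=> de dne0.
have dex := is_derive_scale_arg _ _ _ _ (de (x * (t - 1))).
have [dg _] := is_deriveB dex (is_derive_cst t x 1).
move/derivable1_diffP/differentiable_continuous : dg => cg.
exact: (cvgr_neq0 _ cg dne0).
Qed.

(** One induction on N carries both claims, since the derivative of F^(N) is the value of F^(N+1).
    The point x stays general so that the induction hypothesis applies at all nearby points. *)
Lemma derive1n_eulerian_F e t N x : (forall z : K, is_derive z 1 e (e z)) ->
  e (x * (t - 1)) - t != 0 -> let F := eulerian_F e t in
  F^`(N) x = (eulerian_poly K N t).[F x] /\
  is_derive x 1 F^`(N) (eulerian_poly K N.+1 t).[F x].
Proof.
move=> de + F; elim: N x => [|N IH] x dne0.
  have E0 : eulerian_poly K 0 t = 'X.
    by rewrite /eulerian_poly big_ord1 expr0 !scale1r.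
  rewrite eulerian_polyS E0 derivX mul1r hornerZ hornerD hornerZ.
  rewrite hornerX hornerXn.
  by split=> //; exact: is_derive_eulerian_F.
have dF := is_derive_eulerian_F e t x de dne0.
have FN : \forall y \near x, (eulerian_poly K N.+1 t).[F y] = F^`(N.+1) y.
  near=> y; have [|_ [_ <-]] := IH y; last by rewrite /= derive1E.
  by near: y; exact: near_eulerian_F_ne0.
split; first by have := nbhs_singleton FN.
apply: near_eq_is_derive FN _.
rewrite (eulerian_polyS K N.+1) hornerZ hornerM mulrCA.
rewrite hornerD hornerZ hornerX hornerXn.
exact: is_derive_horner.
Unshelve. all: by end_near. Qed.

End Derivative.

(** * First-order approximation and derivatives *)

Lemma is_derive_linear_approx0 (R : realType) (f : R -> R) (l : R) :
  is_derive (0 : R) 1 f l -> forall eps : R, 0 < eps ->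
  \forall h \near (0 : R), `|f h - f 0 - l * h| <= eps * `|h|.
Proof.
move=> [df <-] eps eps0; have /cvgr_dist_le/(_ eps eps0) := df.
rewrite [\forall t \near 0^', _]near_withinE; apply: filterS => h /=.
(* At h = 0 both sides vanish, so the bound extends from the punctured to the full neighbourhood. *)
have [->|h0] := eqVneq h 0.
  by rewrite mulr0 normr0 !subr0 subrr normr0 mulr0.
move=> /(_ isT); rewrite addr0 /GRing.scale /= mulr1 => le_eps.
set df0 := 'D_1 f 0 in le_eps *.
have -> : f h - f 0 - df0 * h = - (df0 - h^-1 * (f h - f 0)) * h by field.
by rewrite normrM normrN ler_wpM2r.
Qed.

Lemma is_derive_exponential (K : numFieldType) (e : K -> K) :
  {morph e : x y / x + y >-> x * y} ->
  (forall eps : K, 0 < eps ->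
     \forall h \near (0 : K), `|e h - 1 - h| <= eps * `|h|) ->
  forall z : K, is_derive z 1 e (e z).
Proof.
move=> eD e0 z.
have H : h^-1 *: ((e \o shift z) (h *: (1 : K)) - e z) @[h --> (0:K)^'] --> e z.
  apply/cvgrPdist_le => eps eps0.
  (* The error of the difference quotient is, up to sign, (e z / h)(e h - 1 - h). The number q
     bounds |e z| and is positive even if e z = 0, so eps / q is an admissible tolerance. *)
  pose q := `|e z| + 1; have q0 : 0 < q by rewrite ltr_wpDl.
  have := e0 _ (divr_gt0 eps0 q0).
  rewrite [\forall t \near 0^', _]near_withinE; apply: filterS => h /= le_h h0.
  rewrite /GRing.scale /= mulr1 eD.
  have -> : e z - h^-1 * (e h * e z - e z) = - (e z / h * (e h - 1 - h)).
    by field.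
  rewrite normrN !normrM normfV -mulrA [_^-1 * _]mulrC mulrA.
  rewrite ler_pdivrMr ?normr_gt0 //.
  apply: (@le_trans _ _ (q * (eps / q * `|h|))).
    by rewrite ler_pM // lerDl.
  by rewrite mulrA mulrCA divff ?mulr1 // gt_eqF.
apply: DeriveDef; last exact: cvg_lim H.
by apply/cvg_ex; exists (e z).
Qed.

(** * The complex exponential is its own derivative *)

Section Complex.
Variable R : realType.
Local Open Scope complex_scope.
Local Notation C := (R[i] : numFieldType).

Lemma expCD : {morph @expC R : x y / x + y >-> x * y}.
Proof.
move=> [a b] [c d]; rewrite /expC /=; simpc; rewrite expRD cosD sinD.
by congr Complex; ring.
Qed.

(** The squares differ by 2|u||v|. This allows the real and imaginary parts of an error to be
    estimated separately. *)
Lemma normC_le_add (u v : R) : `|u +i* v| <= (`|u| + `|v|)%:C.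
Proof.
rewrite normc_def lecR /= -[leRHS]ger0_norm ?addr_ge0 // -sqrtr_sqr.
rewrite ler_wsqrtr // sqrrD !real_normK ?num_real // addrAC lerDl.
by rewrite mulrn_wge0 // mulr_ge0.
Qed.

Lemma expC_linear_approx (eps : C) : 0 < eps ->
  \forall h \near (0 : C), `|expC h - 1 - h| <= eps * `|h|.
Proof.
(* A positive complex number is real, so eps is a real r > 0. *)
case: eps => r s; rewrite ltcE /= => /andP[/eqP s0 r0]; subst s.
(* With rho = |h|, the bounds on the two parts add up to 4 eta rho + 4 rho^2, which is at most r rho
   once eta and rho are at most r/8. The bound eta <= 1 gives |e^a - 1| <= 2 rho and |sin b| <= 2
   rho. *)
pose eta := Num.min (r / 8) 1.
have eta0 : 0 < eta by rewrite lt_min ltr01 divr_gt0.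
have := is_derive_linear_approx0 _ _ _ (is_derive_expR 0) _ eta0.
have := is_derive_linear_approx0 _ _ _ (is_derive_cos 0) _ eta0.
have := is_derive_linear_approx0 _ _ _ (is_derive_sin 0) _ eta0.
rewrite expR0 sin0 cos0.
move=> /nbhs_norm0P[ds /= ds0 Hs] /nbhs_norm0P[dc /= dc0 Hc].
move=> /nbhs_norm0P[de /= de0 He].
(* The bound 1/2 on rho turns |e^a - 1| <= 2 rho into |e^a| <= 2. *)
pose d := Num.min (Num.min ds (Num.min dc de)) (Num.min (r / 8) (1 / 2)).
have d0 : 0 < d by rewrite !lt_min ds0 dc0 de0 !divr_gt0.
apply/(@nbhs_norm0P _ C); exists d%:C => /=; first by rewrite ltcR.
move=> [a b]; rewrite /= normc_def ltcR /=.
set rho := Num.sqrt _ => rhod.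
have le_a : `|a| <= rho by rewrite -sqrtr_sqr ler_wsqrtr // lerDl sqr_ge0.
have le_b : `|b| <= rho by rewrite -sqrtr_sqr ler_wsqrtr // lerDr sqr_ge0.
move: rhod; rewrite !lt_min => /andP[/and3P[rhos rhoc rhoe] /andP[rho8 rho2]].
have := He a (le_lt_trans le_a rhoe); rewrite mul1r => Ea.
have := Hc b (le_lt_trans le_b rhoc); rewrite oppr0 mul0r subr0 => Cb.
have := Hs b (le_lt_trans le_b rhos); rewrite subr0 mul1r => Sb.
have -> : (expR a * cos b) +i* (expR a * sin b) - 1 - (a +i* b) =
    (expR a * cos b - 1 - a) +i* (expR a * sin b - b).
  by simpc.
apply: le_trans (normC_le_add _ _) _.
have -> : (r +i* 0 * rho%:C) = (r * rho)%:C by simpc.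
rewrite lecR.
have eta8 : eta <= r / 8 by rewrite ge_min lexx.
have eta1 : eta <= 1 by rewrite ge_min lexx orbT.
have rho0 : 0 <= rho by exact: sqrtr_ge0.
have le_eta (u : R) : `|u| <= rho -> eta * `|u| <= eta * rho.
  by move=> le_u; rewrite ler_wpM2l // ltW.
have etarho : eta * rho <= rho by rewrite ler_piMl.
have E1 : `|expR a - 1| <= 2 * rho.
  have := ler_normD (expR a - 1 - a) a; rewrite subrK.
  by have := le_eta a le_a; lra.
have E2 : `|expR a| <= 2.
  by have := ler_normD (expR a - 1) 1; rewrite subrK normr1; lra.
have S1 : `|sin b| <= 2 * rho.
  have := ler_normD (sin b - b) b; rewrite subrK.
  by have := le_eta b le_b; lra.
have Re_le : `|expR a * cos b - 1 - a| <= 3 * (eta * rho).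
  have -> : expR a * cos b - 1 - a =
    expR a * (cos b - 1) + (expR a - 1 - a) by ring.
  have := ler_normD (expR a * (cos b - 1)) (expR a - 1 - a).
  have : `|expR a * (cos b - 1)| <= 2 * (eta * rho).
    by rewrite normrM ler_pM // (le_trans Cb) // le_eta.
  by have := le_eta a le_a; lra.
have Im_le : `|expR a * sin b - b| <= 4 * (rho * rho) + eta * rho.
  (* Both factors of the first product are O(rho), which yields the quadratic term. *)
  have -> : expR a * sin b - b = (expR a - 1) * sin b + (sin b - b) by ring.
  have := ler_normD ((expR a - 1) * sin b) (sin b - b).
  have : `|(expR a - 1) * sin b| <= (2 * rho) * (2 * rho).
    by rewrite normrM ler_pM.
  by have := le_eta b le_b; lra.
have etar : eta * rho <= r / 8 * rho by rewrite ler_wpM2r.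
have rhor : rho * rho <= r / 8 * rho by rewrite ler_wpM2r // ltW.
by lra.
Qed.

Lemma is_derive_expC (z : C) : is_derive z 1 (@expC R : C -> C) (expC z).
Proof. exact: (is_derive_exponential C (@expC R) expCD expC_linear_approx). Qed.

End Complex.

(** Derivability of the lower orders is part of the claim because a derivative is a limit operator
    with a default value where the limit does not exist. *)
Theorem theorem1 (R : realType) :
  (forall (t : R), t != 1 ->
   forall (N : nat) (x : R), expR (x * (t - 1)) - t != 0 ->
     let F := eulerian_F (@expR R) t in
     (forall k : nat, (k < N)%N -> derivable (F^`(k) : R^o -> R^o) x 1) /\
     F^`(N) x = (1 - t) ^+ N *
       \sum_(1 <= i < N.+2) eulerian_coef (i - 1) N t * F x ^+ i) /\
  (forall (t : R[i]), t != 1 ->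
   forall (N : nat) (x : R[i]), expC (x * (t - 1)) - t != 0 ->
     let F := eulerian_F (@expC R) t in
     (forall k : nat, (k < N)%N -> derivable (F^`(k) : R[i]^o -> R[i]^o) x 1) /\
     F^`(N) x = (1 - t) ^+ N *
       \sum_(1 <= i < N.+2) eulerian_coef (i - 1) N t * F x ^+ i).
Proof.
split=> t _ N x dne0 F.
  have H k := derive1n_eulerian_F R (@expR R) t k x (@is_derive_expR R) dne0.
  split=> [k _|]; first by have [_ []] := H k.
  by rewrite -eulerian_polyE; have [] := H N.
have H k := derive1n_eulerian_F _ (@expC R) t k x (is_derive_expC R) dne0.
split=> [k _|]; first by have [_ []] := H k.
by rewrite -eulerian_polyE; have [] := H N.
Qed.
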